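(* Let $n \ge 1$, and let $\varphi : V_n \to W_n$ be the unique isomorphism of $\mathfrak{S}_{2n}$-modules satisfying $\varphi(v_{T_0}) = w_{M_0}$. For $T \in \mathrm{SYT}(n,n)$ and $M \in \mathcal{W}_n$, define $a_{TM} \in \mathbb{C}$ by $$\varphi(v_T) = \sum_{M \in \mathcal{W}_n} a_{TM}\, w_M \qquad (T \in \mathrm{SYT}(n,n)).$$ Then every entry $a_{TM}$ (for $T \in \mathrm{SYT}(n,n)$, $M \in \mathcal{W}_n$) is a nonnegative integer.
   Context: All vector spaces are over $\mathbb{C}$; $\mathfrak{S}_{2n}$ is the symmetric group on $[2n] = \{1,2,\dots,2n\}$. **The module $V_n$ (polytabloids).** An $(n,n)$-tableau is a bijective filling of the $2 \times n$ rectangular Ferrers shape (2 rows of length $n$) with the numbers $1,2,\dots,2n$. For an $(n,n)$-tableau $T$, the (row) tabloid $\{T\}$ is the set of all $(n!)^2$ tableaux obtainable from $T$ by permuting its entries within rows. Let $M^{(n,n)}$ be the $\mathbb{C}$-vector space with basis the set of all tabloids. The group $\mathfrak{S}_{2n}$ acts on tableaux by applying a permutation to the entries, and on $M^{(n,n)}$ by $\sigma.\{T\} = \{\sigma.T\}$. For a tableau $T$, let $C_T \subseteq \mathfrak{S}_{2n}$ be the subgroup of permutations that stabilize (setwise) each column of $T$, let $\varepsilon_T = \sum_{\sigma \in C_T} \mathrm{sign}(\sigma)\,\sigma \in \mathbb{C}[\mathfrak{S}_{2n}]$, and define the polytabloid $v_T = \varepsilon_T.\{T\} \in M^{(n,n)}$.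 Then $V_n$ is the span of all $v_T$, $T$ an $(n,n)$-tableau; it is an $\mathfrak{S}_{2n}$-submodule of $M^{(n,n)}$ because $\sigma.v_T = v_{\sigma.T}$. A tableau is standard if its entries increase down columns and across rows (left to right); $\mathrm{SYT}(n,n)$ is the set of standard $(n,n)$-tableaux. It is known that $V_n$ is irreducible (of shape $(n,n)$) and that $\{v_T : T \in \mathrm{SYT}(n,n)\}$ is a basis of $V_n$ (the polytabloid basis). $T_0 \in \mathrm{SYT}(n,n)$ is the tableau with first row $1,3,5,\dots,2n-1$ and second row $2,4,6,\dots,2n$. **The module $W_n$ (webs).** $\mathcal{W}_n$ is the set of noncrossing perfect matchings $M$ on $[2n]$: writing $a \sim b$ when $a,b$ are matched in $M$, there are no $a<b<c<d$ with both $a \sim c$ and $b \sim d$. $W_n$ is the $\mathbb{C}$-vector space with basis $\{w_M : M \in \mathcal{W}_n\}$ (the web basis). For $1 \le i \le 2n-1$ the adjacent transposition $s_i = (i,i+1)$ acts by $$s_i.w_M = \begin{cases} -w_M & \text{if } i \sim i+1 \text{ in } M,\\ w_M + w_{M'} & \text{otherwise,}\end{cases}$$ where in the second case, if $a \sim i$ and $b \sim i+1$ in $M$, then $M'$ is the noncrossing perfect matching obtained from $M$ by replacing these two pairs with $a \sim b$ and $i \sim i+1$. It is known that this defines an action of $\mathfrak{S}_{2n}$ on $W_n$, and that $W_n$ is irreducible of shape $(n,n)$. $M_0 \in \mathcal{W}_n$ is the matching with $2i-1 \sim 2i$ for all $1 \le i \le n$. It is a known result (Russell–Tymoczko) that there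 exists a unique $\mathfrak{S}_{2n}$-module isomorphism $\varphi: V_n \to W_n$ with $\varphi(v_{T_0}) = w_{M_0}$. *)

(* Defs.v *)
From HB Require Import structures.
From mathcomp Require Import all_boot all_order all_algebra all_fingroup.
From mathcomp Require Import reals complex zify.

Set Implicit Arguments.
Unset Strict Implicit.
Unset Printing Implicit Defensive.

Import GRing.Theory.
Local Open Scope ring_scope.

(* The set [2n] = {1, ..., 2n} is 'I_(2 * n) = {0, ..., 2n-1}: every entry is
   shifted down by one.
   The product s * t of 'S_(2 * n) is "s, then t", so the left actions of the
   symmetric group, in the usual composition convention, are exactly the
   actions of the library, with [to x s] for s.x. *)

(* The vector space with basis I. *)
Notation freeVect F I := {ffun I -> F^o}.

Definition delta (F : fieldType) (I : finType) (x : I) : freeVect F I :=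
  [ffun y => (y == x)%:R].

Lemma freeVectE (F : fieldType) (I : finType) (u : freeVect F I) :
  u = \sum_x u x *: delta F x.
Proof.
apply/ffunP => y; rewrite sum_ffunE (bigD1 y) //= big1 => [|x xy].
  by rewrite !ffunE eqxx addr0 [_ *: _]mulr1.
by rewrite !ffunE eq_sym (negPf xy) [_ *: _]mulr0.
Qed.

(* Linear extension of an action on the basis. *)
Definition lin_act (F : fieldType) (aT : finGroupType) (I : finType)
    (to : {action aT &-> I}) (u : freeVect F I) (s : aT) : freeVect F I :=
  \sum_x u x *: delta F (to x s).

Lemma lin_act_is_linear (F : fieldType) (aT : finGroupType) (I : finType)
    (to : {action aT &-> I}) (s : aT) :
  linear ((lin_act (F := F) to)^~ s).
Proof.
move=> k u v; rewrite /lin_act scaler_sumr -big_split /=.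
by apply: eq_bigr => x _; rewrite !ffunE scalerDl scalerA.
Qed.

Lemma lin_act_delta (F : fieldType) (aT : finGroupType) (I : finType)
    (to : {action aT &-> I}) (x : I) (s : aT) :
  lin_act to (delta F x) s = delta F (to x s).
Proof.
rewrite /lin_act (bigD1 x) //= big1 => [|y yx].
  by rewrite !ffunE eqxx scale1r addr0.
by rewrite !ffunE (negPf yx) scale0r.
Qed.

Lemma lin_actZ (F : fieldType) (aT : finGroupType) (I : finType)
    (to : {action aT &-> I}) (s : aT) (k : F) (u : freeVect F I) :
  lin_act to (k *: u) s = k *: lin_act to u s.
Proof.
rewrite /lin_act scaler_sumr; apply: eq_bigr => x _.
by rewrite !ffunE scalerA.
Qed.

Lemma lin_act_sum (F : fieldType) (aT : finGroupType) (I : finType)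
    (to : {action aT &-> I}) (s : aT) (J : Type) (r : seq J) (P : pred J)
    (u : J -> freeVect F I) :
  lin_act to (\sum_(j <- r | P j) u j) s = \sum_(j <- r | P j) lin_act to (u j) s.
Proof.
apply: (big_morph (fun v => lin_act to v s)) => [v w|].
  by have := lin_act_is_linear to s 1 v w; rewrite !scale1r.
by rewrite -[0 in LHS](scale0r 0) lin_actZ scale0r.
Qed.

Lemma lin_act1 (F : fieldType) (aT : finGroupType) (I : finType)
    (to : {action aT &-> I}) (u : freeVect F I) : lin_act to u 1%g = u.
Proof.
by rewrite [RHS]freeVectE; apply: eq_bigr => x _; rewrite act1.
Qed.

Lemma lin_actM (F : fieldType) (aT : finGroupType) (I : finType)
    (to : {action aT &-> I}) (u : freeVect F I) (s t : aT) :
  lin_act to u (s * t)%g = lin_act to (lin_act to u s) t.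
Proof.
rewrite [in RHS]/lin_act -/(lin_act _ _ _) lin_act_sum.
by apply: eq_bigr => x _; rewrite lin_actZ lin_act_delta actM.
Qed.

Definition lin_action (F : fieldType) (aT : finGroupType) (I : finType)
    (to : {action aT &-> I}) : {action aT &-> freeVect F I} :=
  TotalAction (@lin_act1 F aT I to) (@lin_actM F aT I to).

(* An injective filling is bijective, as both sides have 2n elements; the cell
   (i, j) is in row i and column j. *)
Definition tableau (n : nat) : Type :=
  {T : {ffun 'I_2 * 'I_n -> 'I_(2 * n)} | injectiveb T}.
HB.instance Definition _ (n : nat) := SubFinite.on (tableau n).

Definition entry (n : nat) (T : tableau n) (i : 'I_2) (j : 'I_n) : 'I_(2 * n) :=
  val T (i, j).

Fact tableau_act_proof (n : nat) (T : tableau n) (s : 'S_(2 * n)) :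
  injectiveb [ffun c => s (val T c)].
Proof.
by apply/injectiveP => c d; rewrite !ffunE => /perm_inj /(injectiveP _ (valP T)).
Qed.

Definition tableau_act (n : nat) (T : tableau n) (s : 'S_(2 * n)) : tableau n :=
  Sub [ffun c => s (val T c)] (tableau_act_proof T s).

Lemma tableau_act1 (n : nat) (T : tableau n) : tableau_act T 1%g = T.
Proof. by apply/val_inj/ffunP => c; rewrite ffunE perm1. Qed.

Lemma tableau_actM (n : nat) (T : tableau n) (s t : 'S_(2 * n)) :
  tableau_act T (s * t)%g = tableau_act (tableau_act T s) t.
Proof. by apply/val_inj/ffunP => c; rewrite !ffunE permM. Qed.

Definition tableau_action (n : nat) : {action 'S_(2 * n) &-> tableau n} :=
  TotalAction (@tableau_act1 n) (@tableau_actM n).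

Definition row_equiv (n : nat) (T U : tableau n) : bool :=
  [exists p : {ffun 'I_2 -> 'S_n},
    [forall i, [forall j, entry U i j == entry T i (p i j)]]].

Definition row_class (n : nat) (T : tableau n) : {set tableau n} :=
  [set U | row_equiv T U].

Definition tabloid (n : nat) : Type :=
  {X : {set tableau n} | [exists T, X == row_class T]}.
HB.instance Definition _ (n : nat) := SubFinite.on (tabloid n).

Fact tabloid_of_proof (n : nat) (T : tableau n) :
  [exists U, row_class T == row_class U].
Proof. by apply/existsP; exists T. Qed.

Definition tabloid_of (n : nat) (T : tableau n) : tabloid n :=
  Sub (row_class T) (tabloid_of_proof T).

Lemma row_class_act (n : nat) (T : tableau n) (s : 'S_(2 * n)) :
  [set tableau_act U s | U in row_class T] = row_class (tableau_act T s).
Proof.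
have sub (A : tableau n) (r : 'S_(2 * n)) (U : tableau n) :
    row_equiv A U -> row_equiv (tableau_act A r) (tableau_act U r).
  case/existsP => p /forallP Hp; apply/existsP; exists p.
  apply/forallP => i; apply/forallP => j; rewrite /entry /= !ffunE.
  by move/forallP/(_ j)/eqP: (Hp i); rewrite /entry => ->.
apply/setP => U; apply/imsetP/idP => [[A]|]; rewrite !inE.
  by move=> TA ->; apply: sub.
move=> TU; exists (tableau_act U s^-1%g).
  rewrite inE -[T]tableau_act1 -(mulgV s) tableau_actM; exact: sub.
by rewrite -tableau_actM mulVg tableau_act1.
Qed.

Fact tabloid_act_proof (n : nat) (X : tabloid n) (s : 'S_(2 * n)) :
  [exists T, [set tableau_act U s | U in val X] == row_class T].
Proof.
case/existsP: (valP X) => T /eqP ->; apply/existsP.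
by exists (tableau_act T s); rewrite row_class_act.
Qed.

Definition tabloid_act (n : nat) (X : tabloid n) (s : 'S_(2 * n)) : tabloid n :=
  Sub [set tableau_act U s | U in val X] (tabloid_act_proof X s).

Lemma tabloid_act_of (n : nat) (T : tableau n) (s : 'S_(2 * n)) :
  tabloid_act (tabloid_of T) s = tabloid_of (tableau_act T s).
Proof. by apply/val_inj; rewrite /= row_class_act. Qed.

Lemma tabloid_ofP (n : nat) (X : tabloid n) : exists T, X = tabloid_of T.
Proof.
by case/existsP: (valP X) => T /eqP XT; exists T; apply/val_inj.
Qed.

Lemma tabloid_act1 (n : nat) (X : tabloid n) : tabloid_act X 1%g = X.
Proof.
by case: (tabloid_ofP X) => T ->; rewrite tabloid_act_of tableau_act1.
Qed.

Lemma tabloid_actM (n : nat) (X : tabloid n) (s t : 'S_(2 * n)) :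
  tabloid_act X (s * t)%g = tabloid_act (tabloid_act X s) t.
Proof.
by case: (tabloid_ofP X) => T ->; rewrite !tabloid_act_of tableau_actM.
Qed.

Definition tabloid_action (n : nat) : {action 'S_(2 * n) &-> tabloid n} :=
  TotalAction (@tabloid_act1 n) (@tabloid_actM n).

(* The permutation module M^(n,n). *)
Notation tabloidMod F n := (freeVect F (tabloid n)).

Definition tabloidMod_action (F : fieldType) (n : nat) :
    {action 'S_(2 * n) &-> tabloidMod F n} :=
  lin_action F (tabloid_action n).

Definition column (n : nat) (T : tableau n) (j : 'I_n) : {set 'I_(2 * n)} :=
  [set entry T i j | i : 'I_2].

Definition column_stab (n : nat) (T : tableau n) : {set 'S_(2 * n)} :=
  [set s : 'S_(2 * n) | [forall j, s @: column T j == column T j]].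

Definition polytabloid (F : fieldType) (n : nat) (T : tableau n) :
    tabloidMod F n :=
  \sum_(s in column_stab T)
    (-1) ^+ s *: tabloidMod_action F n (delta F (tabloid_of T)) s.

Definition polytabloid_space (F : fieldType) (n : nat) :
    {vspace tabloidMod F n} :=
  <<[seq polytabloid F T | T : tableau n]>>%VS.

(* The module V_n, as a vector space of its own. *)
Notation polytabloidMod F n := (subvs_of (polytabloid_space F n)).

Fact polytabloid_in (F : fieldType) (n : nat) (T : tableau n) :
  polytabloid F T \in polytabloid_space F n.
Proof. by apply/memv_span/imageP; exists T. Qed.

Definition polytab (F : fieldType) (n : nat) (T : tableau n) :
    polytabloidMod F n :=
  Subvs (polytabloid_in F T).

Lemma column_act (n : nat) (T : tableau n) (s : 'S_(2 * n)) (j : 'I_n) :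
  column (tableau_act T s) j = s @: column T j.
Proof.
rewrite /column -imset_comp; apply: eq_imset => i.
by rewrite /entry /= ffunE.
Qed.

Lemma column_stab_act (n : nat) (T : tableau n) (s t : 'S_(2 * n)) :
  ((t ^ s)%g \in column_stab (tableau_act T s)) = (t \in column_stab T).
Proof.
rewrite !inE; apply: eq_forallb => j; rewrite column_act.
have -> : (t ^ s)%g @: (s @: column T j) = s @: (t @: column T j).
  by rewrite -!imset_comp; apply: eq_imset => x /=; rewrite -!permM -conjgC.
by rewrite (inj_eq (imset_inj (@perm_inj _ s))).
Qed.

Lemma tabloidMod_action_delta (F : fieldType) (n : nat) (T : tableau n)
    (s : 'S_(2 * n)) :
  tabloidMod_action F n (delta F (tabloid_of T)) s
  = delta F (tabloid_of (tableau_act T s)).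
Proof.
by rewrite -tabloid_act_of; exact: (lin_act_delta F (tabloid_action n)).
Qed.

Lemma tabloidMod_actionZ (F : fieldType) (n : nat) (k : F)
    (u : tabloidMod F n) (s : 'S_(2 * n)) :
  tabloidMod_action F n (k *: u) s = k *: tabloidMod_action F n u s.
Proof. exact: (@lin_actZ F _ _ (tabloid_action n) s k u). Qed.

Lemma tabloidMod_action_sum (F : fieldType) (n : nat) (J : Type) (r : seq J)
    (P : pred J) (u : J -> tabloidMod F n) (s : 'S_(2 * n)) :
  tabloidMod_action F n (\sum_(j <- r | P j) u j) s
  = \sum_(j <- r | P j) tabloidMod_action F n (u j) s.
Proof. exact: (@lin_act_sum F _ _ (tabloid_action n) s J r P u). Qed.

Lemma tabloidMod_actionJ (F : fieldType) (n : nat) (T : tableau n)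
    (s t : 'S_(2 * n)) :
  tabloidMod_action F n (tabloidMod_action F n (delta F (tabloid_of T)) t) s
  = tabloidMod_action F n (delta F (tabloid_of (tableau_act T s))) (t ^ s)%g.
Proof.
have aM u a b : tabloidMod_action F n u (a * b)%g
  = tabloidMod_action F n (tabloidMod_action F n u a) b by exact: lin_actM.
rewrite -[LHS]aM conjgC [LHS]aM.
exact: (congr1 (fun u => tabloidMod_action F n u (t ^ s)%g)
               (tabloidMod_action_delta F T s)).
Qed.

Lemma polytabloid_act (F : fieldType) (n : nat) (T : tableau n)
    (s : 'S_(2 * n)) :
  tabloidMod_action F n (polytabloid F T) s = polytabloid F (tableau_act T s).
Proof.
rewrite /polytabloid tabloidMod_action_sum.
rewrite [RHS](reindex_inj (conjg_inj s)).
apply: eq_big => [t|t _]; first by rewrite column_stab_act.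
rewrite tabloidMod_actionZ odd_permJ.
exact: (congr1 (GRing.scale _) (tabloidMod_actionJ F T s t)).
Qed.

Fact polytabloid_space_stable (F : fieldType) (n : nat)
    (u : polytabloidMod F n) (s : 'S_(2 * n)) :
  tabloidMod_action F n (vsval u) s \in polytabloid_space F n.
Proof.
have := subvsP u; rewrite /polytabloid_space => /coord_span ->.
rewrite tabloidMod_action_sum; apply: memv_suml => i _.
rewrite tabloidMod_actionZ; apply: memvZ.
have /(mem_nth 0) : (i < size (image (@polytabloid F n) predT))%N.
  by rewrite size_image; apply: ltn_ord.
case/imageP => T _ ->.
by rewrite polytabloid_act; apply: polytabloid_in.
Qed.

Definition polytabloidMod_act (F : fieldType) (n : nat)
    (u : polytabloidMod F n) (s : 'S_(2 * n)) : polytabloidMod F n :=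
  Subvs (polytabloid_space_stable u s).

Lemma polytabloidMod_act1 (F : fieldType) (n : nat) (u : polytabloidMod F n) :
  polytabloidMod_act u 1%g = u.
Proof. by apply/val_inj; exact: lin_act1. Qed.

Lemma polytabloidMod_actM (F : fieldType) (n : nat) (u : polytabloidMod F n)
    (s t : 'S_(2 * n)) :
  polytabloidMod_act u (s * t)%g
  = polytabloidMod_act (polytabloidMod_act u s) t.
Proof. by apply/val_inj; exact: lin_actM. Qed.

Definition polytabloidMod_action (F : fieldType) (n : nat) :
    {action 'S_(2 * n) &-> polytabloidMod F n} :=
  TotalAction (@polytabloidMod_act1 F n) (@polytabloidMod_actM F n).

Definition standard (n : nat) (T : tableau n) : Prop :=
  (forall (i i' : 'I_2) (j : 'I_n), (i < i')%N -> (entry T i j < entry T i' j)%N)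
  /\ (forall (i : 'I_2) (j j' : 'I_n),
        (j < j')%N -> (entry T i j < entry T i j')%N).

Fact T0_entry_lt (n : nat) (c : 'I_2 * 'I_n) : (2 * c.2 + c.1 < 2 * n)%N.
Proof. by have := ltn_ord c.1; have := ltn_ord c.2; lia. Qed.

Fact T0_proof (n : nat) : injectiveb [ffun c => Ordinal (@T0_entry_lt n c)].
Proof.
apply/injectiveP => -[i j] [i' j']; rewrite !ffunE => /(congr1 val) /= e.
have := ltn_ord i; have := ltn_ord i' => i2 i'2.
by congr (_, _); apply/val_inj => /=; lia.
Qed.

(* First row 1, 3, ..., 2n-1 and second row 2, 4, ..., 2n, shifted. *)
Definition T0 (n : nat) : tableau n :=
  Sub [ffun c => Ordinal (@T0_entry_lt n c)] (T0_proof n).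

(* A perfect matching is given by the fixed-point-free involution f which sends
   each point to its partner: a ~ b means f a = b. *)
Definition perfect_matching (n : nat) (f : {ffun 'I_(2 * n) -> 'I_(2 * n)}) :
    bool :=
  [forall a, (f (f a) == a) && (f a != a)].

Definition noncrossing (n : nat) (f : {ffun 'I_(2 * n) -> 'I_(2 * n)}) : bool :=
  ~~ [exists a : 'I_(2 * n), exists b : 'I_(2 * n), exists c : 'I_(2 * n),
      exists d : 'I_(2 * n),
       [&& (a < b)%N, (b < c)%N, (c < d)%N, f a == c & f b == d]].

Definition ncmatching (n : nat) : Type :=
  {f : {ffun 'I_(2 * n) -> 'I_(2 * n)} | perfect_matching f && noncrossing f}.
HB.instance Definition _ (n : nat) := SubFinite.on (ncmatching n).

Definition partner (n : nat) (M : ncmatching n) (a : 'I_(2 * n)) : 'I_(2 * n) :=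
  val M a.

Lemma partnerK (n : nat) (M : ncmatching n) : involutive (partner M).
Proof. by move=> a; case/andP: (valP M) => /forallP/(_ a)/andP[/eqP]. Qed.

Lemma partner_neq (n : nat) (M : ncmatching n) (a : 'I_(2 * n)) :
  partner M a != a.
Proof. by case/andP: (valP M) => /forallP/(_ a)/andP[]. Qed.

Lemma partner_nc (n : nat) (M : ncmatching n) (a b : 'I_(2 * n)) :
  (a < b)%N -> (b < partner M a)%N -> (partner M a < partner M b)%N -> False.
Proof.
move=> ab bc cd; case/andP: (valP M) => _ /negP; apply.
apply/existsP; exists a; apply/existsP; exists b.
apply/existsP; exists (partner M a); apply/existsP; exists (partner M b).
by rewrite ab bc cd !eqxx.
Qed.

Definition reconnect_fun (n : nat) (M : ncmatching n) (i j : 'I_(2 * n)) :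
    {ffun 'I_(2 * n) -> 'I_(2 * n)} :=
  [ffun x => if x == i then j else if x == j then i
             else if x == partner M i then partner M j
             else if x == partner M j then partner M i
             else partner M x].

Fact reconnect_proof (n : nat) (M : ncmatching n) (i j : 'I_(2 * n)) :
  j = i.+1 :> nat ->
  perfect_matching (reconnect_fun M i j) && noncrossing (reconnect_fun M i j).
Proof.
move=> ij; set f := reconnect_fun M i j.
have [Mij|Mij] := eqVneq (partner M i) j.
  have -> : f = val M.
    have Mji : partner M j = i by rewrite -Mij partnerK.
    apply/ffunP => x; rewrite ffunE Mij Mji.
    by do 4?[case: eqP => [->|_]]; rewrite /= -/(partner M _) ?Mij ?Mji.
  exact: valP M.
have K := partnerK M; have neq := partner_neq M.
have ji : (j == i) = false by apply/eqP => /(congr1 val) /=; lia.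
have pi : (partner M i == i) = false by apply: negbTE.
have qj : (partner M j == j) = false by apply: negbTE.
have pj : (partner M i == j) = false by apply: negbTE.
have qi : (partner M j == i) = false by rewrite (can2_eq K K) eq_sym.
have qp : (partner M j == partner M i) = false by rewrite (inj_eq (inv_inj K)).
have fE x : f x = if x == i then j else if x == j then i
             else if x == partner M i then partner M j
             else if x == partner M j then partner M i
             else partner M x by rewrite ffunE.
apply/andP; split.
  apply/forallP => x; rewrite !fE.
  have [->|xi] := eqVneq x i; first by rewrite ji !eqxx.
  have [->|xj] := eqVneq x j; first by rewrite !eqxx eq_sym ji.
  have [->|xp] := eqVneq x (partner M i).
    by rewrite ?qi ?qj ?qp ?pi ?pj ?eqxx.
  have [->|xq] := eqVneq x (partner M j).
    by rewrite ?qi ?qj ?qp ?pi ?pj ?eqxx eq_sym ?qp.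
  rewrite -(can2_eq K K) in xp; rewrite -(can2_eq K K) in xq.
  by rewrite (negPf xp) (negPf xq) !(inj_eq (inv_inj K)) (negPf xi) (negPf xj)
    K eqxx neq.
apply/negP => /existsP[a /existsP[b /existsP[c /existsP[d]]]].
case/and5P => ab bc cd /eqP fa /eqP fb; move: ab bc cd; rewrite -{}fa -{}fb !fE.
have nc (x y : 'I_(2 * n)) : (x < y)%N -> (y < partner M x)%N ->
  (partner M x < partner M y)%N -> False by exact: partner_nc.
have neqn (x y : 'I_(2 * n)) : x != y ->
    nat_of_ord x <> nat_of_ord y /\
    nat_of_ord (partner M x) <> nat_of_ord (partner M y).
  move=> xy; split=> /val_inj; first by apply/eqP.
  by move/(inv_inj K); apply/eqP.
clear neq f fE.
have ltji x : (j < x)%N -> (x < i)%N -> False by lia.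
have [->|ai] := eqVneq a i; first by move=> h; rewrite ij ltnS leqNgt h.
have [->|aj] := eqVneq a j; first by move=> h /(ltji _ h).
have [->|bi] := eqVneq b i; first by move=> _ h; rewrite ij ltnS leqNgt h.
have [->|bj] := eqVneq b j; first by move=> _ h /(ltji _ h).
have [->|ap] := eqVneq a (partner M i).
  have [->|bp] := eqVneq b (partner M i); first by rewrite ltnn.
  have [->|bq] := eqVneq b (partner M j); first by rewrite ltnn.
  move: (nc j b) (nc (partner M i) b) (nc b (partner M j)).
  move: (neqn _ _ bi) (neqn _ _ bj) (neqn _ _ bp) (neqn _ _ bq).
  by rewrite !K; clear -ij; lia.
have [->|aq] := eqVneq a (partner M j).
  have [->|bp] := eqVneq b (partner M i); first by rewrite ltnn.
  have [->|bq] := eqVneq b (partner M j); first by rewrite ltnn.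
  move: (nc i b) (nc (partner M j) b) (nc b (partner M i)).
  move: (neqn _ _ bi) (neqn _ _ bj) (neqn _ _ bp) (neqn _ _ bq).
  by rewrite !K; clear -ij; lia.
move: (neqn _ _ ai) (neqn _ _ aj) (neqn _ _ ap) (neqn _ _ aq); rewrite !K.
have [->|bp] := eqVneq b (partner M i).
  by move: (nc a j) (nc i a) (nc a (partner M i)); rewrite !K; clear -ij; lia.
have [->|bq] := eqVneq b (partner M j).
  by move: (nc a i) (nc j a) (nc a (partner M j)); rewrite !K; clear -ij; lia.
by move=> _ _ _ _; exact: nc.
Qed.

(* For j = i + 1, the matching M' obtained from M by replacing the pairs
   a ~ i and b ~ j with a ~ b and i ~ j. *)
Definition reconnect (n : nat) (M : ncmatching n) (i j : 'I_(2 * n))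
    (ij : j = i.+1 :> nat) : ncmatching n :=
  Sub (reconnect_fun M i j) (reconnect_proof M ij).

Fact M0_partner_lt (n : nat) (a : 'I_(2 * n)) :
  ((if odd a then a.-1 else a.+1) < 2 * n)%N.
Proof. by have := ltn_ord a; case: ifP; lia. Qed.

Fact M0_proof (n : nat) :
  let f := [ffun a => Ordinal (@M0_partner_lt n a)] in
  perfect_matching f && noncrossing f.
Proof.
apply/andP; split.
  apply/forallP => a; rewrite !ffunE; apply/andP; split.
    by apply/eqP/val_inj => /=; case: (ifP (odd a)); case: ifP; lia.
  by apply/eqP => /(congr1 val) /=; case: ifP; lia.
apply/negP => /existsP[a /existsP[b /existsP[c /existsP[d]]]].
case/and5P => ab bc cd /eqP; rewrite !ffunE => /(congr1 val) /= ac _.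
by move: ac; case: ifP; lia.
Qed.

(* 2i-1 ~ 2i, which is 2k ~ 2k+1 after the shift. *)
Definition M0 (n : nat) : ncmatching n :=
  Sub [ffun a => Ordinal (@M0_partner_lt n a)] (M0_proof n).

Notation webMod F n := (freeVect F (ncmatching n)).

Definition web (F : fieldType) (n : nat) (M : ncmatching n) : webMod F n :=
  delta F M.

(* The simple transpositions generate 'S_(2 * n), so at most one
   action satisfies this. *)
Definition is_web_action (F : fieldType) (n : nat)
    (rho : {action 'S_(2 * n) &-> webMod F n}) : Prop :=
  (forall s : 'S_(2 * n), linear (rho^~ s)) /\
  (forall (M : ncmatching n) (i j : 'I_(2 * n)) (ij : j = i.+1 :> nat),
     rho (web F M) (tperm i j) =
       if partner M i == j then - web F M
       else web F M + web F (reconnect M ij)).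

(* Main.v *)
Require Import Defs.
From HB Require Import structures.
From mathcomp Require Import all_boot all_order all_algebra all_fingroup.
From mathcomp Require Import reals complex zify ring.

Set Implicit Arguments.
Unset Strict Implicit.
Unset Printing Implicit Defensive.

Import GRing.Theory.
Local Open Scope ring_scope.

(* Both modules are realized by polynomials in variables x_1, ..., x_2n: a
   tabloid becomes the product of the x_b over its bottom row, so v_T becomes the
   Specht polynomial \prod_j (x_(b_j) - x_(a_j)) over the columns (a_j, b_j) of
   T; the web w_M is sent to \prod (x_b - x_a) over the arcs a < b of M. The
   Plücker relation
     (x_c - x_a)(x_d - x_b) = (x_b - x_a)(x_d - x_c) + (x_d - x_a)(x_c - x_b)
   is the rule by which s_i acts on webs, so the second map is equivariant, and
   composed with phi it is the first one, since both agree at v_(T_0). As the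
   first is injective and phi onto, the second is injective, so it suffices to
   expand Specht polynomials of standard tableaux into noncrossing products; the
   same relation resolves the crossings a < b < c < d with positive signs. *)

(** * Entries of a tableau *)

Lemma entry_inj (n : nat) (T : tableau n) (i i' : 'I_2) (j j' : 'I_n) :
  entry T i j = entry T i' j' -> i = i' /\ j = j'.
Proof. by move/(injectiveP _ (valP T)) => [-> ->]. Qed.

Lemma entry_eq (n : nat) (T : tableau n) (i i' : 'I_2) (j j' : 'I_n) :
  (entry T i j == entry T i' j') = (i == i') && (j == j').
Proof.
apply/eqP/andP => [/entry_inj[-> ->]|[/eqP-> /eqP->]] //.
Qed.

Lemma entry_bij (n : nat) (T : tableau n) :
  bijective (fun c : 'I_2 * 'I_n => entry T c.1 c.2).
Proof.
apply: inj_card_bij; last by rewrite card_prod !card_ord.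
by move=> [i j] [i' j'] /entry_inj[/= -> ->].
Qed.

Variant entry_spec (n : nat) (T : tableau n) (a : 'I_(2 * n)) : Prop :=
  EntrySpec i j of a = entry T i j.

Lemma entryP (n : nat) (T : tableau n) (a : 'I_(2 * n)) : entry_spec T a.
Proof.
by have [g _ gK] := entry_bij T; exists (g a).1 (g a).2; rewrite gK.
Qed.

Lemma entry_act (n : nat) (T : tableau n) (s : 'S_(2 * n)) i j :
  entry (tableau_act T s) i j = s (entry T i j).
Proof. by rewrite /entry /= ffunE. Qed.

Lemma ord2P (i : 'I_2) : i = ord0 \/ i = ord_max.
Proof. by case: i => [[|[|//]] p]; [left|right]; apply/val_inj. Qed.

Lemma rev_ord2 :
  (rev_ord (ord0 : 'I_2) = ord_max) * (rev_ord (ord_max : 'I_2) = ord0).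
Proof. by split; apply/val_inj. Qed.

(** * Specht polynomials and products over matchings *)

(** The part of standardness that survives uncrossing: exchanging entries between columns may
    destroy the order along rows. *)
Definition incr_columns (n : nat) (T : tableau n) :=
  forall j, (entry T ord0 j < entry T ord_max j)%N.

(** Polynomials are represented by their values at all points [x], so that a permutation acts by
    precomposition. *)
Definition specht (F : fieldType) (n : nat) (T : tableau n)
    (x : 'I_(2 * n) -> F) : F :=
  \prod_j (x (entry T ord_max j) - x (entry T ord0 j)).

Definition match_poly (F : fieldType) (n : nat)
    (f : {ffun 'I_(2 * n) -> 'I_(2 * n)}) (x : 'I_(2 * n) -> F) : F :=
  \prod_(a : 'I_(2 * n) | (a < f a)%N) (x (f a) - x a).

(** The arcs of [f] are the columns of [T], and the lower end of each arc is its top entry, so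
    columns index the arcs. *)
Lemma match_poly_specht (F : fieldType) (n : nat) (T : tableau n)
    (f : {ffun 'I_(2 * n) -> 'I_(2 * n)}) (x : 'I_(2 * n) -> F) :
  incr_columns T ->
  (forall j, f (entry T ord0 j) = entry T ord_max j) ->
  (forall j, f (entry T ord_max j) = entry T ord0 j) ->
  match_poly f x = specht T x.
Proof.
move=> Tincr f0 f1; have [g gK Kg] := entry_bij T.
rewrite /match_poly (reindex (entry T ord0)) /=.
  by apply: eq_big => [j|j _]; rewrite f0 ?Tincr.
exists (fun a => (g a).2) => [j _|a]; first by rewrite (gK (ord0, j)).
case: (entryP T a) => i j ->{a}; rewrite inE (gK (i, j)) /=.
case: (ord2P i) => -> //; rewrite f1.
by move=> lt10; have := ltn_trans lt10 (Tincr j); rewrite ltnn.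
Qed.

Lemma specht_act (F : fieldType) (n : nat) (T : tableau n)
    (s : 'S_(2 * n)) (x : 'I_(2 * n) -> F) :
  specht (tableau_act T s) x = specht T (x \o s).
Proof. by apply: eq_bigr => j _; rewrite !entry_act. Qed.

(** The matching pairs the two entries of each column; since columns increase, a crossing of arcs is
    exactly a forbidden pair of columns. *)
Lemma specht_noncrossing (F : fieldType) (n : nat) (T : tableau n) :
  incr_columns T ->
  (forall j k, (entry T ord0 j < entry T ord0 k)%N ->
     (entry T ord0 k < entry T ord_max j)%N ->
     (entry T ord_max j < entry T ord_max k)%N -> False) ->
  exists M : ncmatching n, forall x : 'I_(2 * n) -> F,
    specht T x = match_poly (val M) x.
Proof.
move=> Tincr nc; have [g gK Kg] := entry_bij T.
pose f := [ffun a => entry T (rev_ord (g a).1) (g a).2].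
have fE i j : f (entry T i j) = entry T (rev_ord i) j.
  by rewrite ffunE (gK (i, j)).
have fM : perfect_matching f && noncrossing f.
  apply/andP; split.
    apply/forallP => a; case: (entryP T a) => i j ->{a}.
    rewrite !fE rev_ordK eqxx /= entry_eq.
    by case: (ord2P i) => ->; rewrite ?rev_ord2.
  apply/negP => /existsP[a /existsP[b /existsP[c /existsP[d]]]].
  case/and5P => ab bc cd /eqP fa /eqP fb; move: ab bc cd; rewrite -{}fa -{}fb.
  case: (entryP T a) => i j ->; case: (entryP T b) => i' j' ->; rewrite !fE.
  have := nc j j'; move: (Tincr j) (Tincr j').
  case: (ord2P i) => ->; case: (ord2P i') => ->; rewrite ?rev_ord2; lia.
exists (exist _ f fM) => x /=; rewrite (match_poly_specht x Tincr) // => j.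
  by rewrite fE rev_ord2.
by rewrite fE rev_ord2.
Qed.

(** * Resolving crossings, with a measure that decreases *)

(* [l * (N - l)] is strictly concave, and increasing as long as [2 * l <= N]. *)
Definition weight (N l : nat) : nat := (l * (N - l))%N.

Lemma weight_uncross (N a b c d : nat) :
  (a < b)%N -> (b < c)%N -> (c < d)%N -> (2 * d <= N)%N ->
  (weight N (b - a) + weight N (d - c) < weight N (c - a) + weight N (d - b))%N
  /\ (weight N (d - a) + weight N (c - b)
        < weight N (c - a) + weight N (d - b))%N.
Proof.
move=> ab bc cd dN.
(* In terms of the gaps p, q, r between the four points and the remainder m of [N], all positive,
   the two drops in weight are 2qm and 2pr. *)
have [p bE] : exists p, b = (a + p.+1)%N by exists (b - a).-1; lia.
have [q cE] : exists q, c = (b + q.+1)%N by exists (c - b).-1; lia.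
have [r dE] : exists r, d = (c + r.+1)%N by exists (d - c).-1; lia.
have [m NE] : exists m, (N = p.+1 + q.+1 + r.+1 + m.+1)%N.
  by exists (N - (p.+1 + q.+1 + r.+1)).-1; lia.
have -> : (b - a = p.+1)%N by lia.
have -> : (c - b = q.+1)%N by lia.
have -> : (d - c = r.+1)%N by lia.
have -> : (c - a = p.+1 + q.+1)%N by lia.
have -> : (d - b = q.+1 + r.+1)%N by lia.
have -> : (d - a = p.+1 + q.+1 + r.+1)%N by lia.
move: p.+1 q.+1 r.+1 m.+1 (ltn0Sn p) (ltn0Sn q) (ltn0Sn r) (ltn0Sn m) NE.
clear; move=> p q r m p0 q0 r0 m0 ->; rewrite /weight.
have -> : (p + q + r + m - p = q + r + m)%N by lia.
have -> : (p + q + r + m - r = p + q + m)%N by lia.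
have -> : (p + q + r + m - q = p + r + m)%N by lia.
have -> : (p + q + r + m - (p + q) = r + m)%N by lia.
have -> : (p + q + r + m - (q + r) = p + m)%N by lia.
have -> : (p + q + r + m - (p + q + r) = m)%N by lia.
have lt_add x y z : (y = x + 2 * z)%N -> (0 < z)%N -> (x < y)%N by lia.
split.
  by apply: (lt_add _ _ (q * m)%N); [ring|rewrite muln_gt0 q0].
by apply: (lt_add _ _ (p * r)%N); [ring|rewrite muln_gt0 p0].
Qed.

(** The termination measure for uncrossing. The plain sum of the lengths would not do: it is the
    same for a crossing pair and for the nested pair on the same four points. Entries are below 2n,
    so [4 * n] meets the bound of [weight_uncross]. *)
Definition spread (n : nat) (T : tableau n) : nat :=
  \sum_j weight (4 * n) (entry T ord_max j - entry T ord0 j).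

Lemma bigD2 (R : Type) (idx : R) (op : Monoid.com_law idx) (I : finType)
    (j k : I) (G : I -> R) : (k == j) = false ->
  \big[op/idx]_i G i
  = op (op (G j) (G k)) (\big[op/idx]_(i | (i != j) && (i != k)) G i).
Proof. by move=> kj; rewrite (bigD1 j) // (bigD1 k) ?kj //= Monoid.mulmA. Qed.

(** Let columns j and k be (a, c) and (b, d) with a < b < c < d. Exchanging b and c gives the
    columns (a, b), (c, d) of [T1]; exchanging c and d gives (a, d), (b, c) in [T2]. The other
    columns contribute a common factor to the Plücker relation. *)
Lemma specht_uncross (F : fieldType) (n : nat) (T : tableau n) j k :
  incr_columns T -> (entry T ord0 j < entry T ord0 k)%N ->
  (entry T ord0 k < entry T ord_max j)%N ->
  (entry T ord_max j < entry T ord_max k)%N ->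
  let T1 := tableau_act T (tperm (entry T ord0 k) (entry T ord_max j)) in
  let T2 := tableau_act T (tperm (entry T ord_max j) (entry T ord_max k)) in
  [/\ incr_columns T1 /\ incr_columns T2,
      (spread T1 < spread T)%N /\ (spread T2 < spread T)%N &
      forall x : 'I_(2 * n) -> F, specht T x = specht T1 x + specht T2 x].
Proof.
move=> Tincr ab bc cd T1 T2.
have kj : (k == j) = false by apply/eqP => e; rewrite e ltnn in ab.
have jk : (j == k) = false by rewrite eq_sym.
have T1E : ((entry T1 ord0 j = entry T ord0 j) *
            (entry T1 ord_max j = entry T ord0 k) *
            (entry T1 ord0 k = entry T ord_max j) *
            (entry T1 ord_max k = entry T ord_max k))%type.
  by rewrite !entry_act tpermL tpermR !tpermD ?entry_eq ?kj ?jk ?eqxx.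
have T2E : ((entry T2 ord0 j = entry T ord0 j) *
            (entry T2 ord_max j = entry T ord_max k) *
            (entry T2 ord0 k = entry T ord0 k) *
            (entry T2 ord_max k = entry T ord_max j))%type.
  by rewrite !entry_act tpermL tpermR !tpermD ?entry_eq ?kj ?jk ?eqxx.
have T1D i l : (l != j) && (l != k) -> entry T1 i l = entry T i l.
  case/andP=> lj lk; rewrite entry_act tpermD //.
    by rewrite entry_eq (eq_sym k) (negPf lk) andbF.
  by rewrite entry_eq (eq_sym j) (negPf lj) andbF.
have T2D i l : (l != j) && (l != k) -> entry T2 i l = entry T i l.
  case/andP=> lj lk; rewrite entry_act tpermD //.
    by rewrite entry_eq (eq_sym j) (negPf lj) andbF.
  by rewrite entry_eq (eq_sym k) (negPf lk) andbF.
split.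
- split=> l; have [->|lj] := eqVneq l j; rewrite ?T1E ?T2E //.
  + by have [->|lk] := eqVneq l k; rewrite ?T1E // !T1D ?lj.
  + exact: ltn_trans ab (ltn_trans bc cd).
  + by have [->|lk] := eqVneq l k; rewrite ?T2E // !T2D ?lj.
- rewrite /spread !(bigD2 _ _ kj) !T1E !T2E.
  set r1 := (\sum_(l | _) _)%N; set r2 := (\sum_(l | _) _)%N.
  have -> : r1 = r2 by apply: eq_bigr => l lP; rewrite !T1D.
  set r3 := (\sum_(l | _) _)%N.
  have -> : r3 = r2 by apply: eq_bigr => l lP; rewrite !T2D.
  have dn := ltn_ord (entry T ord_max k).
  have dN : (2 * entry T ord_max k <= 4 * n)%N by lia.
  have := weight_uncross ab bc cd dN.
  by rewrite !ltn_add2r.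
- move=> x; rewrite /specht !(bigD2 _ _ kj) /= !T1E !T2E.
  set r := \prod_(l | _) _.
  rewrite [X in _ = _ * X + _](_ : _ = r); last first.
    by apply: eq_bigr => l lP; rewrite !T1D.
  rewrite [X in _ = _ + _ * X](_ : _ = r); last first.
    by apply: eq_bigr => l lP; rewrite !T2D.
  ring.
Qed.

(** Induction on the spread: a crossing splits the polynomial into two of smaller spread, whose
    coefficients add up; without crossings there is a single term. *)
Lemma specht_expansion (F : fieldType) (n : nat) (T : tableau n) :
  incr_columns T ->
  exists k : ncmatching n -> nat, forall x : 'I_(2 * n) -> F,
    specht T x = \sum_M (k M)%:R * match_poly (val M) x.
Proof.
have [m] := ubnP (spread T); elim: m T => // m IH T /ltnSE leTm Tincr.
pose crossing j k := [&& (entry T ord0 j < entry T ord0 k)%N,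
  (entry T ord0 k < entry T ord_max j)%N &
  (entry T ord_max j < entry T ord_max k)%N].
have [/existsP[j /existsP[k /and3P[ab bc cd]]]|nc] :=
  boolP [exists j, exists k, crossing j k].
  have [[incr1 incr2] [lt1 lt2] TE] := specht_uncross F Tincr ab bc cd.
  have [k1 k1E] := IH _ (leq_trans lt1 leTm) incr1.
  have [k2 k2E] := IH _ (leq_trans lt2 leTm) incr2.
  exists (fun M => k1 M + k2 M)%N => x; rewrite TE k1E k2E -big_split /=.
  by apply: eq_bigr => M _; rewrite natrD mulrDl.
have [|M ME] := specht_noncrossing F Tincr.
  move=> j k ab bc cd; case/negP: nc.
  by apply/existsP; exists j; apply/existsP; exists k; apply/and3P.
exists (fun N => (N == M) : nat) => x; rewrite ME (bigD1 M) //= eqxx mul1r.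
by rewrite big1 ?addr0 // => N /negPf ->; rewrite mul0r.
Qed.

(** * Adjacent transpositions acting on matching products *)

(** The factor of the arc through [a], whichever of its two ends [a] is. *)
Definition arc (F : fieldType) (n : nat) (f : {ffun 'I_(2 * n) -> 'I_(2 * n)})
    (x : 'I_(2 * n) -> F) (a : 'I_(2 * n)) : F :=
  if (a < f a)%N then x (f a) - x a else x a - x (f a).

Lemma match_poly_split (F : fieldType) (n : nat)
    (f : {ffun 'I_(2 * n) -> 'I_(2 * n)}) (x : 'I_(2 * n) -> F) a b :
  perfect_matching f -> b != a -> b != f a ->
  match_poly f x = arc f x a * arc f x b *
    \prod_(y : 'I_(2 * n) | (y < f y)%N && (y \notin [:: a; f a; b; f b]))
       (x (f y) - x y).
Proof.
move=> /forallP fP ba bfa.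
have fK y : f (f y) = y by case/andP: (fP y) => /eqP.
have fne y : nat_of_ord (f y) <> nat_of_ord y.
  by case/andP: (fP y) => _ /eqP fy /val_inj.
(* The product is indexed by lower ends, so the arcs through [a] and [b] are extracted at [lo a] and
   [lo b]. *)
pose lo (y : 'I_(2 * n)) := if (y < f y)%N then y else f y.
have lo_lt (y : 'I_(2 * n)) : (lo y < f (lo y))%N.
  by rewrite /lo; case: ifP => // le_fy; rewrite fK; have := fne y; lia.
have arcE y : arc f x y = x (f (lo y)) - x (lo y).
  by rewrite /arc /lo; case: ifP; rewrite ?fK.
have neq_lo (y z : 'I_(2 * n)) :
    (y < f y)%N -> (y != lo z) = (y != z) && (y != f z).
  move=> lty; rewrite /lo; case: ifP => ltz.
    have -> : (y == f z) = false.
      by apply/eqP => e; move: lty; rewrite e fK; lia.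
    by rewrite andbT.
  have -> // : (y == z) = false by apply/eqP => e; move: lty; rewrite e ltz.
have lo_ba : lo b != lo a.
  rewrite neq_lo // /lo; case: ifP => _; rewrite ?ba ?bfa //.
  rewrite (inj_eq (can_inj fK)) ba andbT.
  by apply: contra bfa => /eqP <-; rewrite fK.
rewrite /match_poly (bigD1 (lo a)) //= (bigD1 (lo b)) ?lo_lt //= mulrA !arcE.
congr (_ * _); apply: eq_bigl => y; have [lty|] //= := ltnP y (f y).
by rewrite !neq_lo // !inE !negb_or !andbA.
Qed.

Lemma matching_perfect (n : nat) (M : ncmatching n) : perfect_matching (val M).
Proof. by case/andP: (valP M). Qed.

(** If [i] and [j] are matched, only their own factor changes, by a sign. Otherwise the arcs away
    from [i], [j] and their partners give a common factor, and a Plücker relation in four variables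
    remains. *)
Lemma match_poly_tperm (F : fieldType) (n : nat) (M : ncmatching n)
    (i j : 'I_(2 * n)) (ij : j = i.+1 :> nat) (x : 'I_(2 * n) -> F) :
  match_poly (val M) (x \o tperm i j) =
    if partner M i == j then - match_poly (val M) x
    else match_poly (val M) x + match_poly (val (reconnect M ij)) x.
Proof.
have K := partnerK M; have Kinj := inv_inj K.
have lt_ij : (i < j)%N by rewrite ij.
have ij_neq : i != j by apply: contraTneq lt_ij => ->; rewrite ltnn.
case: eqVneq => [Mij|Mij].
  have Mji : partner M j = i by rewrite -Mij K.
  rewrite /match_poly (bigD1 i) -/(partner _ _) ?Mij //=.
  rewrite [in RHS](bigD1 i) -/(partner _ _) ?Mij //= -mulNr opprB.
  rewrite tpermL tpermR; congr (_ * _).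
  apply: eq_bigr => y; rewrite -/(partner _ _) => /andP[lty yi].
  have yj : y != j by apply: contraTneq lty => ->; rewrite Mji -leqNgt ltnW.
  rewrite /= !tpermD // 1?eq_sym //.
    by rewrite -Mji (inj_eq Kinj).
  by rewrite -Mij (inj_eq Kinj).
have Mne := partner_neq M.
have ji : j != i by rewrite eq_sym.
have jMi : j != partner M i by rewrite eq_sym.
rewrite (match_poly_split _ (matching_perfect M) ji) -/(partner M i) //.
rewrite [in RHS](match_poly_split _ (matching_perfect M) ji) -/(partner M i) //.
have M'i : partner (reconnect M ij) i = j by rewrite /partner /= ffunE eqxx.
have M'Mi : partner (reconnect M ij) (partner M i) = partner M j.
  by rewrite /partner /= ffunE (negPf (Mne i)) (negPf Mij) eqxx.
have Mij' : partner M i != partner (reconnect M ij) i by rewrite M'i.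
(* The two new arcs are reached from [i] and from [partner M i], as [i] and [j] now lie on the same
   arc. *)
rewrite (match_poly_split _ (matching_perfect (reconnect M ij)) (Mne i) Mij').
rewrite -!/(partner _ _) M'i M'Mi.
set r := (X in _ = _ * X + _).
rewrite [X in _ * _ * X = _](_ : _ = r); last first.
  apply: eq_bigr => y /andP[_]; rewrite !inE !negb_or -!/(partner _ _).
  case/and4P=> yi yMi yj yMj; rewrite /= !tpermD // 1?eq_sym //.
    by apply: contra yMi => /eqP <-; rewrite K.
  by apply: contra yMj => /eqP <-; rewrite K.
rewrite [X in _ = _ + _ * X](_ : _ = r); last first.
  have mem4 y : (y \in [:: i; j; partner M i; partner M j])
      = (y \in [:: i; partner M i; j; partner M j]).
    by rewrite !inE [X in _ || X]orbCA.
  have M'E y : y \notin [:: i; partner M i; j; partner M j] ->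
      val (reconnect M ij) y = val M y.
    rewrite !inE !negb_or => /and4P[/negPf yi /negPf yMi /negPf yj /negPf yMj].
    by rewrite /= ffunE yi yj yMi yMj.
  apply: eq_big => y; rewrite mem4; last by case/andP=> _ /M'E ->.
  by rewrite andbC [RHS]andbC; case: (boolP (y \notin _)) => //= /M'E ->.
rewrite -mulrDl; congr (_ * _); rewrite /arc -!/(partner _ _) M'i M'Mi.
clear M'i M'Mi Mij'; rewrite /= tpermL tpermR lt_ij.
rewrite !tpermD ?Mne // 1?eq_sym //; last 1 first.
  by apply: contra jMi => /eqP <-; rewrite K.
have nc := partner_nc (M := M).
have := nc i j; have := nc (partner M i) i; have := nc (partner M j) i.
have := nc (partner M j) (partner M i); have := nc (partner M i) (partner M j).
rewrite !K.
have neq (a b : 'I_(2 * n)) : a != b -> nat_of_ord a <> nat_of_ord b.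
  by move/eqP=> ab /val_inj.
have := neq _ _ Mij; have := neq _ _ (Mne i); have := neq _ _ (Mne j).
have : partner M j != i by apply: contra jMi => /eqP <-; rewrite K.
move/neq; have : partner M i != partner M j by rewrite (inj_eq Kinj).
move/neq; move: (partner M i) (partner M j) ij => c d ji_eq.
move=> h1 h2 h3 h4 h5 nc1 nc2 nc3 nc4 nc5.
(* As [M] is noncrossing, only the orders d < c < i < j, c < i < j < d and i < j < d < c survive. *)
have [ci|ci] := ltnP c i; have [di|di] := ltnP d i; have [cd|cd] := ltnP c d;
  try (exfalso; lia).
- have -> : (i < c)%N = false by lia.
  have -> : (j < d)%N = false by lia.
  ring.
- have -> : (i < c)%N = false by lia.
  have -> : (j < d)%N by lia.
  ring.
- have -> : (i < c)%N by lia.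
  have -> : (j < d)%N by lia.
  ring.
Qed.

(** * Equivariant evaluation of webs *)

Definition web_eval (F : fieldType) (n : nat) (x : 'I_(2 * n) -> F)
    (w : webMod F n) : F^o :=
  \sum_M w M * match_poly (val M) x.

Fact web_eval_is_linear (F : fieldType) (n : nat) (x : 'I_(2 * n) -> F) :
  linear (web_eval x).
Proof.
move=> k u v; rewrite /web_eval scaler_sumr -big_split /=.
by apply: eq_bigr => M _; rewrite !ffunE mulrDl -mulrA.
Qed.
HB.instance Definition _ (F : fieldType) (n : nat) (x : 'I_(2 * n) -> F) :=
  GRing.isLinear.Build F (webMod F n) F^o _ (web_eval x)
    (web_eval_is_linear x).

Lemma web_eval_web (F : fieldType) (n : nat) (x : 'I_(2 * n) -> F)
    (M : ncmatching n) :
  web_eval x (web F M) = match_poly (val M) x.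
Proof.
rewrite /web_eval (bigD1 M) //= ffunE eqxx mul1r big1 ?addr0 // => N NM.
by rewrite ffunE (negPf NM) mul0r.
Qed.

(** Web actions are specified on adjacent transpositions only. Transpositions generate the group,
    and any of them is reached from an adjacent one by conjugating with adjacent ones. *)
Lemma perm_ind_adjacent (m : nat) (P : 'S_m -> Prop) :
  P 1%g -> (forall s t, P s -> P t -> P (s * t)%g) ->
  (forall i j : 'I_m, j = i.+1 :> nat -> P (tperm i j)) ->
  forall s, P s.
Proof.
move=> P1 PM Padj.
have Plt d (i j : 'I_m) : j = (i + d.+1)%N :> nat -> P (tperm i j).
  elim: d j => [|d IH] j ij; first by apply: Padj; rewrite ij addn1.
  (* [k] is j - 1; conjugation by the exchange of [k] and [j] lengthens the transposition by one. *)
  have km : (i + d.+1 < m)%N by have := ltn_ord j; lia.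
  pose k := Ordinal km.
  have kj : nat_of_ord j = k.+1 by rewrite /= ij addnS.
  have -> : tperm i j = (tperm i k ^ tperm k j)%g.
    by rewrite tpermJ tpermL tpermD // -val_eqE /=; apply/eqP; lia.
  rewrite conjgE tpermV; apply: (PM); first exact: Padj.
  by apply: PM; [exact: IH | exact: Padj].
move=> s; have [ts -> _] := prod_tpermP s.
elim/big_ind: _ => // -[i j] _ /=.
have [ij|ij|/val_inj ->] := ltngtP i j; last by rewrite tperm1.
  by apply: (Plt (j - i).-1); lia.
by rewrite tpermC; apply: (Plt (i - j).-1); lia.
Qed.

(* [actM] and [act1] only cover actions on a finType. *)
Lemma total_actM (aT : finGroupType) (rT : Type) (to : {action aT &-> rT})
    (x : rT) (a b : aT) :
  to x (a * b)%g = to (to x a) b.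
Proof.
have [_ toM] : is_action setT to by case: to.
by apply: (toM x); apply: in_setT.
Qed.

(** Acting by 1 is an injective idempotent map, hence the identity. *)
Lemma total_act1 (aT : finGroupType) (rT : Type) (to : {action aT &-> rT})
    (x : rT) :
  to x 1%g = x.
Proof.
have inj1 : injective (to^~ 1%g) by case: to => ? [].
by apply: inj1; rewrite -total_actM mulg1.
Qed.

(** Keeping [w] and [x] general makes the property stable under products, so the generators suffice;
    there it is [match_poly_tperm] extended linearly. *)
Lemma web_eval_act (F : fieldType) (n : nat)
    (rho : {action 'S_(2 * n) &-> webMod F n}) (s : 'S_(2 * n))
    (w : webMod F n) (x : 'I_(2 * n) -> F) :
  is_web_action rho -> web_eval x (rho w s) = web_eval (x \o s) w.
Proof.
move=> [rho_lin rho_adj]; move: s w x; apply: perm_ind_adjacent.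
- move=> w x; have -> : rho w 1%g = w by exact: total_act1.
  apply: eq_bigr => M _; congr (_ * _).
  by apply: eq_bigr => a _; rewrite /= !perm1.
- move=> s t IHs IHt w x.
  have -> : rho w (s * t)%g = rho (rho w s) t by exact: total_actM.
  rewrite IHt IHs; apply: eq_bigr => M _.
  by congr (_ * _); apply: eq_bigr => a _; rewrite /= !permM.
move=> i j ij w x.
pose rhoL : {linear webMod F n -> webMod F n} :=
  HB.pack (rho^~ (tperm i j))
    (GRing.isLinear.Build _ _ _ _ _ (rho_lin (tperm i j))).
have -> : rho w (tperm i j) = \sum_M w M *: rho (web F M) (tperm i j).
  rewrite {1}[w]freeVectE; rewrite -[LHS]/(rhoL _) linear_sum.
  by apply: eq_bigr => M _; rewrite linearZ.
rewrite linear_sum /=; apply: eq_bigr => M _.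
rewrite linearZ /= (rho_adj M i j ij) (match_poly_tperm M ij); congr (_ * _).
by case: ifP => _; rewrite ?linearN ?linearD /= !web_eval_web.
Qed.

(** * Tabloids as squarefree monomials *)

(** All representatives have the same set of bottom entries; the union avoids choosing one. *)
Definition bottom (n : nat) (X : tabloid n) : {set 'I_(2 * n)} :=
  \bigcup_(T in val X) [set entry T ord_max j | j : 'I_n].

Lemma bottom_of (n : nat) (T : tableau n) :
  bottom (tabloid_of T) = [set entry T ord_max j | j : 'I_n].
Proof.
apply/setP => a; apply/bigcupP/imsetP => [[U]|[j _ ->]].
  rewrite inE => /existsP[p /forallP /(_ ord_max)/forallP TU] /imsetP[j _ ->].
  by exists (p ord_max j); rewrite // (eqP (TU j)).
exists T; last by apply/imsetP; exists j.
rewrite inE; apply/existsP; exists [ffun=> 1%g].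
by apply/forallP => i; apply/forallP => k; rewrite ffunE perm1.
Qed.

Lemma card_bottom (n : nat) (X : tabloid n) : #|bottom X| = n.
Proof.
have [T ->] := tabloid_ofP X; rewrite bottom_of card_imset ?card_ord //.
by move=> j k /entry_inj[].
Qed.

(** The top row is the complement of the bottom one, so equal bottom sets force each entry of [U]
    into the same row of [T]; its position there defines the row permutation. *)
Lemma row_equiv_bottom (n : nat) (T U : tableau n) :
  bottom (tabloid_of T) = bottom (tabloid_of U) -> row_equiv T U.
Proof.
rewrite !bottom_of => TU.
have ex i j : exists k, entry U i j == entry T i k.
  have [h k Uij] := entryP T (entry U i j); exists k; rewrite Uij entry_eq eqxx.
  rewrite andbT.
  have : (entry U i j \in [set entry T ord_max j | j : 'I_n])
       = (entry U i j \in [set entry U ord_max j | j : 'I_n]) by rewrite TU.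
  have mem V i' j' :
      (entry V i' j' \in [set entry V ord_max j | j : 'I_n]) = (i' == ord_max).
    apply/imsetP/eqP => [[l _ /entry_inj[]]//|->]; by exists j'.
  rewrite mem Uij mem.
  by case: (ord2P h) => ->; case: (ord2P i) => ->.
pose p i j := xchoose (ex i j).
have pE i j : entry U i j = entry T i (p i j) by apply/eqP/(xchooseP (ex i j)).
have p_inj i : injective (p i).
  by move=> j k e; have := pE i j; rewrite e -pE => /entry_inj[].
apply/existsP; exists [ffun i => perm (p_inj i)].
by apply/forallP => i; apply/forallP => j; rewrite ffunE permE pE.
Qed.

Lemma row_equivC (n : nat) (T U : tableau n) : row_equiv T U -> row_equiv U T.
Proof.
case/existsP => p /forallP pP; apply/existsP; exists [ffun i => (p i)^-1%g].
apply/forallP => i; apply/forallP => j; rewrite ffunE.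
by have /forallP/(_ ((p i)^-1 j)%g)/eqP -> := pP i; rewrite permKV.
Qed.

Lemma row_equiv_trans (n : nat) (T U V : tableau n) :
  row_equiv T U -> row_equiv U V -> row_equiv T V.
Proof.
case/existsP => p /forallP pP /existsP[q /forallP qP].
apply/existsP; exists [ffun i => (q i * p i)%g].
apply/forallP => i; apply/forallP => j; rewrite ffunE permM.
have /forallP/(_ j)/eqP -> := qP i; exact: (forallP (pP i)).
Qed.

Lemma bottom_inj (n : nat) : injective (@bottom n).
Proof.
move=> X Y; have [T ->] := tabloid_ofP X; have [U ->] := tabloid_ofP Y.
move/row_equiv_bottom => TU; apply/val_inj/setP => V; rewrite !inE.
by apply/idP/idP; apply: row_equiv_trans => //; apply: row_equivC.
Qed.

Definition tabloid_eval (F : fieldType) (n : nat) (x : 'I_(2 * n) -> F)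
    (u : tabloidMod F n) : F^o :=
  \sum_X u X * \prod_(a in bottom X) x a.

Fact tabloid_eval_is_linear (F : fieldType) (n : nat) (x : 'I_(2 * n) -> F) :
  linear (tabloid_eval x).
Proof.
move=> k u v; rewrite /tabloid_eval scaler_sumr -big_split /=.
by apply: eq_bigr => X _; rewrite !ffunE mulrDl -mulrA.
Qed.
HB.instance Definition _ (F : fieldType) (n : nat) (x : 'I_(2 * n) -> F) :=
  GRing.isLinear.Build F (tabloidMod F n) F^o _ (tabloid_eval x)
    (tabloid_eval_is_linear x).

Lemma tabloid_eval_delta (F : fieldType) (n : nat) (x : 'I_(2 * n) -> F)
    (T : tableau n) :
  tabloid_eval x (delta F (tabloid_of T)) = \prod_j x (entry T ord_max j).
Proof.
rewrite /tabloid_eval (bigD1 (tabloid_of T)) //= ffunE eqxx mul1r.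
rewrite [X in _ + X]big1 ?addr0 => [|X XT]; last first.
  by rewrite ffunE (negPf XT) mul0r.
rewrite bottom_of big_imset //= => j k _ _; by case/entry_inj.
Qed.

(** At the indicator function of [bottom X], a monomial survives only if its set lies in [bottom X].
    All these sets have n elements, so the value is the coefficient of [X]. *)
Lemma tabloid_eval_eq0 (F : fieldType) (n : nat) (u : tabloidMod F n) :
  (forall x, tabloid_eval x u = 0) -> u = 0.
Proof.
move=> u0; apply/ffunP => X; rewrite ffunE.
have := u0 (fun a => (a \in bottom X)%:R).
rewrite /tabloid_eval (bigD1 X) //= [X in _ + X]big1 ?addr0 => [|Y YX].
  by rewrite big1 ?mulr1 // => a ->.
have [sYX|/subsetPn[a aY aX]] := boolP (bottom Y \subset bottom X).
  case/eqP: YX; apply: bottom_inj; apply/eqP.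
  by rewrite eqEcard sYX !card_bottom leqnn.
by rewrite (bigD1 a) //= (negPf aX) mul0r mulr0.
Qed.

(** * Column stabilizers and the evaluation of polytabloids *)

(** Parametrizes the column stabilizer by the set of columns whose two entries are exchanged. *)
Definition flip (n : nat) (T : tableau n) (f : {ffun 'I_n -> bool}) :
    'S_(2 * n) :=
  (\prod_j if f j then tperm (entry T ord0 j) (entry T ord_max j) else 1)%g.

Lemma flip_entry (n : nat) (T : tableau n) (f : {ffun 'I_n -> bool}) i j :
  flip T f (entry T i j) = entry T (if f j then rev_ord i else i) j.
Proof.
pose t k := (if f k then tperm (entry T ord0 k) (entry T ord_max k) else 1)%g.
have tE k h : t k (entry T h j)
    = entry T (if (k == j) && f k then rev_ord h else h) j.
  rewrite /t; case: (f k); last by rewrite andbF perm1.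
  rewrite andbT; case: eqVneq => [->|kj].
    by case: (ord2P h) => ->; rewrite ?tpermL ?tpermR rev_ord2.
  by rewrite tpermD // entry_eq (negPf kj) andbF.
(* Generalized to lists for the induction; without repetitions, column [j] is flipped at most
   once. *)
have prodE r h : uniq r -> (\prod_(k <- r) t k)%g (entry T h j)
    = entry T (if (j \in r) && f j then rev_ord h else h) j.
  elim: r h => [|k r IH] h; first by rewrite big_nil perm1.
  rewrite big_cons permM tE inE eq_sym => /= /andP[kr /IH ->].
  by case: eqVneq kr => [->|//] /negPf -> /=; case: (f j).
rewrite [LHS](prodE (index_enum _)) ?index_enum_uniq //.
by rewrite mem_index_enum.
Qed.

Lemma sign_flip (F : fieldType) (n : nat) (T : tableau n)
    (f : {ffun 'I_n -> bool}) :
  (-1) ^+ flip T f = \prod_j (-1) ^+ f j :> F.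
Proof.
rewrite (big_morph (fun s : 'S_(2 * n) => (-1) ^+ s : F)
  (id1 := 1) (op1 := *%R)) => [|s t|]; last by rewrite odd_perm1.
  apply: eq_bigr => j _; case: (f j); last by rewrite odd_perm1.
  by rewrite odd_tperm entry_eq.
by rewrite odd_permM signr_addb.
Qed.

Lemma flip_in (n : nat) (T : tableau n) (f : {ffun 'I_n -> bool}) :
  flip T f \in column_stab T.
Proof.
rewrite inE; apply/forallP => j.
rewrite eqEcard card_imset ?leqnn ?andbT; last exact: perm_inj.
apply/subsetP => _ /imsetP[_ /imsetP[i _ ->] ->].
by rewrite flip_entry; apply/imsetP; eexists.
Qed.

(** On each column, [s] is the identity or the exchange, and its effect on the top entry tells
    which. *)
Lemma flip_onto (n : nat) (T : tableau n) (s : 'S_(2 * n)) :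
  s \in column_stab T ->
  flip T [ffun j => s (entry T ord0 j) != entry T ord0 j] = s.
Proof.
rewrite inE => /forallP sP; apply/permP => a; case: (entryP T a) => i j ->{a}.
have sE h : exists h', s (entry T h j) = entry T h' j.
  have : s (entry T h j) \in column T j.
    by rewrite -(eqP (sP j)); apply/imset_f/imset_f.
  by case/imsetP => h' _ ->; exists h'.
rewrite flip_entry ffunE; have [h0 s0] := sE ord0; have [h1 s1] := sE ord_max.
have ne : h0 != h1.
  apply/eqP => e; have /perm_inj/entry_inj[//] :
    s (entry T ord0 j) = s (entry T ord_max j) by rewrite s0 s1 e.
rewrite s0 entry_eq eqxx andbT.
by case: (ord2P i) => ->; rewrite ?s0 ?s1; move: ne;
  case: (ord2P h0) => ->; case: (ord2P h1) => ->; rewrite ?rev_ord2.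
Qed.

(** Expanding the product of the two-term column factors gives one signed monomial for each set of
    flipped columns, that is, for each element of the column stabilizer. *)
Lemma tabloid_eval_polytabloid (F : fieldType) (n : nat)
    (x : 'I_(2 * n) -> F) (T : tableau n) :
  tabloid_eval x (polytabloid F T) = specht T x.
Proof.
(* [b] tells whether column [j] is flipped, which puts its former top entry in the bottom row and
   costs a sign. *)
pose y j (b : bool) := (-1) ^+ b *
  x (entry T (if b then ord0 else ord_max) j).
have -> : specht T x = \prod_j \sum_b y j b.
  by apply: eq_bigr => j _; rewrite big_bool /y mulN1r mul1r addrC.
rewrite bigA_distr_bigA.
have -> : polytabloid F T = \sum_(s in column_stab T)
    (-1) ^+ s *: delta F (tabloid_of (tableau_act T s)).
  by apply: eq_bigr => s _; rewrite tabloidMod_action_delta.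
rewrite linear_sum /=.
rewrite (reindex (flip T)) /=; last first.
  exists (fun s : 'S_(2 * n) =>
    [ffun j => s (entry T ord0 j) != entry T ord0 j]) => [f _|s sT].
    apply/ffunP => j; rewrite ffunE flip_entry entry_eq eqxx andbT.
    by case: (f j); rewrite ?rev_ord2.
  exact: flip_onto.
apply: eq_big => [f|f _]; first by rewrite flip_in.
rewrite linearZ /= tabloid_eval_delta sign_flip.
rewrite /y big_split /=; congr (_ * _); apply: eq_bigr => j _.
by rewrite entry_act flip_entry rev_ord2.
Qed.

(** * Comparison of the two evaluations through [phi] *)

Lemma act_transitive (n : nat) (T U : tableau n) :
  exists s, tableau_act T s = U.
Proof.
have [g gK Kg] := entry_bij T.
have s_inj : injective (fun a => entry U (g a).1 (g a).2).
  move=> a b /entry_inj[e1 e2]; apply: (can_inj Kg).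
  by rewrite [LHS]surjective_pairing e1 e2 -surjective_pairing.
exists (perm s_inj); apply/val_inj/ffunP => -[i j].
by rewrite ffunE permE -[val T _]/(entry T i j) (gK (i, j)).
Qed.

Lemma incr_columns_T0 (n : nat) : incr_columns (T0 n).
Proof. by move=> j; rewrite /entry /= !ffunE /=; lia. Qed.

Lemma match_poly_M0 (F : fieldType) (n : nat) (x : 'I_(2 * n) -> F) :
  match_poly (val (M0 n)) x = specht (T0 n) x.
Proof.
apply: match_poly_specht => [|j|j]; first exact: incr_columns_T0.
  by apply/val_inj; rewrite /entry /= !ffunE /=; case: ifP; lia.
by apply/val_inj; rewrite /entry /= !ffunE /=; case: ifP; lia.
Qed.

Lemma eq_linear_polytab (F : fieldType) (n : nat)
    (L1 L2 : {linear polytabloidMod F n -> F^o}) :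
  (forall T, L1 (polytab F T) = L2 (polytab F T)) -> L1 =1 L2.
Proof.
move=> L12 u.
(* Coordinates with respect to the spanning list are indexed by positions; a tableau is chosen for
   each position. *)
have ex (k : 'I_#|{: tableau n}|) :
    exists T, [seq polytabloid F T | T : tableau n]`_k == polytabloid F T.
  have /(mem_nth 0)/imageP[T _ ->] :
    (k < size [seq polytabloid F T | T : tableau n])%N by rewrite size_image.
  by exists T.
have [c ->] : exists c, u = \sum_k c k *: polytab F (xchoose (ex k)).
  have /coord_span uE := subvsP u; eexists; apply/val_inj.
  rewrite /= linear_sum /= [LHS]uE; apply: eq_bigr => k _.
  by rewrite -(eqP (xchooseP (ex k))).
by rewrite !linear_sum; apply: eq_bigr => k _; rewrite !linearZ /= L12.
Qed.

Theorem theorem1p2 (R : realType) (n : nat) (n_ge1 : (1 <= n)%N)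
    (rho : {action 'S_(2 * n) &-> webMod R[i] n})
    (rho_web : is_web_action rho)
    (phi : {linear polytabloidMod R[i] n -> webMod R[i] n})
    (phi_bij : bijective phi)
    (phi_equiv : forall (u : polytabloidMod R[i] n) (s : 'S_(2 * n)),
       phi (polytabloidMod_action R[i] n u s) = rho (phi u) s)
    (phi_T0 : phi (polytab R[i] (T0 n)) = web R[i] (M0 n))
    (a : tableau n -> ncmatching n -> R[i])
    (a_coef : forall T : tableau n, standard T ->
       phi (polytab R[i] T) = \sum_(M : ncmatching n) a T M *: web R[i] M) :
  forall (T : tableau n) (M : ncmatching n), standard T ->
    exists k : nat, a T M = k%:R.
Proof.
(* Any tableau is a translate of [T0], so equivariance carries the equality over from [T0], where
   the columns are the arcs of [M0]. *)
have phi_polytab x T : web_eval x (phi (polytab R[i] T)) = specht T x.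
  have [s <-] := act_transitive (T0 n) T.
  have -> : polytab R[i] (tableau_act (T0 n) s)
      = polytabloidMod_action R[i] n (polytab R[i] (T0 n)) s.
    by apply/val_inj; rewrite /= -polytabloid_act.
  rewrite phi_equiv web_eval_act // phi_T0 web_eval_web match_poly_M0.
  by rewrite specht_act.
have phi_eval x u : web_eval x (phi u) = tabloid_eval x (vsval u).
  move: u; apply: (eq_linear_polytab (L1 := web_eval x \o phi)
                     (L2 := tabloid_eval x \o vsval)) => T /=.
  by rewrite phi_polytab tabloid_eval_polytabloid.
(* Every [w] is the image under [phi] of some [psi w], whose tabloid evaluations then all vanish. *)
have web_eval_inj (w : webMod R[i] n) : (forall x, web_eval x w = 0) -> w = 0.
  have [psi _ psiK] := phi_bij; rewrite -(psiK w) => w0.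
  rewrite [psi w](_ : _ = 0) ?linear0 //; apply/val_inj/tabloid_eval_eq0 => x.
  by rewrite -phi_eval w0.
move=> T M Tstd; have Tincr : incr_columns T by move=> j; apply: (proj1 Tstd).
have [k kE] := specht_expansion R[i] Tincr.
exists (k M); pose w := \sum_N (k N)%:R *: web R[i] N.
have w_phi : phi (polytab R[i] T) = w.
  apply/eqP; rewrite -subr_eq0; apply/eqP/web_eval_inj => x.
  have e : web_eval x (phi (polytab R[i] T)) = web_eval x w.
    rewrite phi_polytab kE linear_sum; apply: eq_bigr => N _.
    by rewrite linearZ /= web_eval_web.
  by rewrite linearB /= e; apply: subrr.
(* Webs are the basis functions, so the coefficient at [N] is the value at [N]. *)
have coefE (b : ncmatching n -> R[i]) N : (\sum_L b L *: web R[i] L) N = b N.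
  rewrite sum_ffunE (bigD1 N) //= big1 => [|L LN].
    by rewrite !ffunE eqxx addr0 [_ *: _]mulr1.
  by rewrite !ffunE eq_sym (negPf LN) [_ *: _]mulr0.
by rewrite -[LHS](coefE (a T)) -a_coef // w_phi coefE.
Qed.
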